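(* Let $\ell(\cdot,y_i)$ satisfy $\ell''(z,y_i)\ge\beta$ for all $|z|\le r$ and all $i=1,\dots,n$, where $\beta>0$ (derivatives in $z$). Let $\rho=\lambda/\beta$ with $\lambda>0$, and consider the preconditioned problem $$\min_{v\in\mathbb{R}^d}\ \frac1n\sum_{i=1}^n\phi(v^\top H^{-1/2}x_i,y_i)+\frac{\beta}{2}\|v\|_2^2 .$$ (1) If $\ell(\cdot,y_i)$ is $L$-Lipschitz continuous for every $i$, then the condition number of the preconditioned problem (in the Lipschitz sense) is bounded by $$\frac{(L+\beta r)^2\,\mu(\rho)\,\gamma(C,\rho)}{\beta}.$$ (2) If $\ell(\cdot,y_i)$ is $L$-smooth for every $i$, then the condition number of the preconditioned problem (in the smooth sense) is bounded by $$\frac{(L-\beta)\,\mu(\rho)\,\gamma(C,\rho)}{\beta}.$$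
   Context: Data: $x_1,\dots,x_n\in\mathbb{R}^d$ (not all zero), labels $y_1,\dots,y_n$; $\ell(z,y)$ is a loss function, convex in its first (scalar) argument $z$. The original regularized loss minimization problem is $\min_{w\in\mathbb{R}^d}\frac1n\sum_{i=1}^n\ell(x_i^\top w,y_i)+\frac{\lambda}{2}\|w\|_2^2$ with $\lambda>0$. The number $r>0$ is an upper bound on the absolute value of the first argument of the loss; throughout, the loss is only considered for $|z|\le r$. Definitions: $\phi(z,y)=\ell(z,y)-\frac{\beta}{2}z^2$; $C=\frac1n\sum_{i=1}^n x_ix_i^\top$; $H=\rho I+C$. A function of a scalar is $L$-Lipschitz if $|f(z_1)-f(z_2)|\le L|z_1-z_2|$, and $L$-smooth if it is differentiable with $L$-Lipschitz derivative. Let $X=(x_1,\dots,x_n)\in\mathbb{R}^{d\times n}$ with singular value decomposition $\frac{1}{\sqrt n}X=U\Sigma V^\top$, where $n\ge d$, $U\in\mathbb{R}^{d\times d}$ is orthogonal, $V\in\mathbb{R}^{n\times d}$ has orthonormal columns, $\Sigma=\mathrm{diag}(\sigma_1,\dots,\sigma_d)$, $\sigma_1\ge\dots\ge\sigma_d\ge0$. The numerical rank is $\gamma(C,\rho)=\sum_{j=1}^d\frac{\sigma_j^2}{\sigma_j^2+\rho}$. The generalized incoherence is $$\mu(\rho)=\max_{1\le i\le n}\frac{n}{\gamma(C,\rho)}\sum_{j=1}^d\frac{\sigma_j^2}{\sigma_j^2+\rho}V_{ij}^2 .$$ Condition number: for a problem $\min_v\frac1n\sum_i g_i(v^\top\hat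 x_i)+\frac{\kappa}{2}\|v\|_2^2$ (with Euclidean norm), the condition number in the Lipschitz sense is $\bar L^2/\kappa$, where $\bar L$ is the smallest common Lipschitz constant, with respect to $v$, of the functions $v\mapsto g_i(v^\top\hat x_i)$ on $\{v:|v^\top\hat x_i|\le r\}$, $i=1,\dots,n$; in the smooth sense it is $\bar L/\kappa$, where $\bar L$ is the smallest common Lipschitz constant of the gradients (with respect to $v$) of these functions on the same sets. *)

(* Defs.v *)
From HB Require Import structures.
From mathcomp Require Import all_boot all_order all_algebra.
From mathcomp Require Import all_classical all_reals all_analysis.

Set Implicit Arguments.
Unset Strict Implicit.
Unset Printing Implicit Defensive.

Import Order.TTheory GRing.Theory Num.Theory.
Import numFieldNormedType.Exports.

Local Open Scope ring_scope.
Local Open Scope classical_set_scope.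

Section Scalar.
Context {R : realType}.
Implicit Types (f : R -> R) (z r L : R).

Definition abs_le r : set R := [set z | `|z| <= r].

(* The neighbourhood condition makes f^`() the genuine derivative of f around
   z, so that f^`(2) z is the second derivative of f at z. *)
Definition twice_derivable f z : Prop :=
  (\forall t \near z, derivable f t 1) /\ derivable f^`() z 1.

Definition smooth_on L (A : set R) f : Prop :=
  (forall z, A z -> derivable f z 1) /\ L.-lipschitz_A f^`().

End Scalar.

Section Euclidean.
Context {R : realType} {d : nat}.
Implicit Types (u v : 'cV[R]_d) (A S : 'M[R]_d).

Definition dot u v : R := (u^T *m v) 0 0.

(* The library norm on matrices is the sup norm; topologically it is
   equivalent, but Lipschitz constants must be taken for this one. *)
Definition enorm v : R := Num.sqrt (dot v v).

Definition gradient (f : 'cV[R]_d -> R) v : 'cV[R]_d :=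
  \col_j 'D_(delta_mx j 0) f v.

Definition psdmx A : Prop := A^T = A /\ forall u, 0 <= dot u (A *m u).

(* The positive semidefinite square root, which exists and is unique when A is
   itself positive semidefinite (default value 0 otherwise). *)
Definition sqrtmx A : 'M[R]_d := xget 0 [set S | psdmx S /\ S *m S = A].

End Euclidean.

(* The data of the problem
     min_v 1/n \sum_i loss i (v^T feature i) + reg/2 ||v||^2. *)
Record rlm_problem (R : realType) (n d : nat) := RlmProblem {
  loss : 'I_n -> R -> R;
  feature : 'I_n -> 'cV[R]_d;
  reg : R }.

Section ConditionNumber.
Context {R : realType} {n d : nat}.
Variables (r : R) (P : rlm_problem R n d).

Definition loss_at (i : 'I_n) (v : 'cV[R]_d) : R :=
  loss P i (dot v (feature P i)).

Definition slab (i : 'I_n) : set 'cV[R]_d :=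
  [set v | `|dot v (feature P i)| <= r].

Definition common_lipschitz (K : R) : Prop :=
  0 <= K /\ forall i v w, slab i v -> slab i w ->
    `|loss_at i v - loss_at i w| <= K * enorm (v - w).

Definition common_smooth (K : R) : Prop :=
  0 <= K /\ forall i,
    (forall v, slab i v -> differentiable (loss_at i) v) /\
    (forall v w, slab i v -> slab i w ->
      enorm (gradient (loss_at i) v - gradient (loss_at i) w)
        <= K * enorm (v - w)).

(* The smallest constants: +oo when there is none; otherwise the infimum is
   attained, the conditions on K being closed. *)
Definition lipschitz_const : \bar R :=
  ereal_inf [set K%:E | K in [set K | common_lipschitz K]].

Definition smooth_const : \bar R :=
  ereal_inf [set K%:E | K in [set K | common_smooth K]].

Definition cond_lipschitz : \bar R :=
  (lipschitz_const ^+ 2 * ((reg P)^-1)%:E)%E.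

Definition cond_smooth : \bar R := (smooth_const * ((reg P)^-1)%:E)%E.

End ConditionNumber.

Section Data.
Context {R : realType} {n d : nat}.
Implicit Types (x : 'I_n -> 'cV[R]_d) (rho beta : R).
Implicit Types (U : 'M[R]_d) (sigma : 'rV[R]_d) (V : 'M[R]_(n, d)).

Definition data_mx x : 'M[R]_(d, n) := \matrix_(j, i) x i j 0.

Definition second_moment x : 'M[R]_d := n%:R^-1 *: \sum_i x i *m (x i)^T.

Definition reg_second_moment x rho : 'M[R]_d := rho%:M + second_moment x.

(* X / sqrt n = U Sigma V^T *)
Record is_svd x U sigma V : Prop := IsSvd {
  svd_left : U^T *m U = 1%:M;
  svd_right : V^T *m V = 1%:M;
  svd_ge0 : forall j, 0 <= sigma 0 j;
  svd_sorted : forall j k : 'I_d, (j <= k)%N -> sigma 0 k <= sigma 0 j;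
  svd_eq : (Num.sqrt n%:R)^-1 *: data_mx x = U *m diag_mx sigma *m V^T }.

Definition numerical_rank sigma rho : R :=
  \sum_j sigma 0 j ^+ 2 / (sigma 0 j ^+ 2 + rho).

(* The terms are nonnegative when 0 <= rho, so the default 0 is harmless. *)
Definition incoherence sigma V rho : R :=
  \big[Num.max/0]_(i < n)
    (n%:R / numerical_rank sigma rho *
     \sum_j sigma 0 j ^+ 2 / (sigma 0 j ^+ 2 + rho) * V i j ^+ 2).

Definition shifted_loss (Y : Type) (ell : R -> Y -> R) beta (z : R) (y : Y) :=
  ell z y - beta / 2 * z ^+ 2.

Definition precond_problem (Y : Type) (ell : R -> Y -> R) (y : 'I_n -> Y)
    x beta rho : rlm_problem R n d :=
  {| loss := fun i z => shifted_loss ell beta z (y i);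
     feature := fun i => invmx (sqrtmx (reg_second_moment x rho)) *m x i;
     reg := beta |}.

End Data.

(* Main.v *)
Require Import Defs.
From HB Require Import structures.
From mathcomp Require Import all_boot all_order all_algebra.
From mathcomp Require Import ring lra.
From mathcomp Require Import all_classical all_reals all_analysis.

(** The bounds separate into a scalar and a geometric part. For a problem whose
    losses are [g_i] of [v^T f_i], the Lipschitz constant with respect to [v] of
    each term is at most that of [g_i] times [||f_i||], and the Lipschitz
    constant of its gradient is at most that of the derivative of [g_i] times
    [||f_i||^2]
    ([cond_lipschitz_le], [cond_smooth_le]).

    Scalar part. Subtracting [beta z^2 / 2] adds at most [beta r] to a Lipschitz
    constant on the interval [|z| <= r] ([lipschitz_subr_sqr]). For smoothness
    it helps: since the second derivative of the loss is at least [beta], the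
    derivative of the shifted loss is still nondecreasing, and its increments
    lose a term [beta (z - w)] ([smooth_on_subr_sqr]).

    Geometric part. In the left singular basis [U], the matrix [H] is diagonal
    with entries [sigma_j^2 + rho], and [U^T x_i] has entries
    [sqrt n sigma_j V_ij]. Hence the squared norm of the preconditioned feature
    is [x_i^T H^-1 x_i = n \sum_j sigma_j^2 / (sigma_j^2 + rho) V_ij^2]
    ([precond_feature_sqr]), which the incoherence times the numerical rank
    bounds by definition ([precond_feature_le]). Dividing by the regularization
    parameter [beta] gives both bounds. *)

Import Order.TTheory GRing.Theory Num.Theory.
Import numFieldNormedType.Exports.

Local Open Scope ring_scope.
Local Open Scope classical_set_scope.

(** * Euclidean inner product and ridge functions *)

Section EuclideanSpace.
Context {R : realType} {d : nat}.
Implicit Types (u v w f : 'cV[R]_d) (A : 'M[R]_d).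

Lemma dotE u v : dot u v = \sum_i u i 0 * v i 0.
Proof. by rewrite /dot mxE; apply: eq_bigr => i _; rewrite mxE. Qed.

Lemma dotC u v : dot u v = dot v u.
Proof. by rewrite !dotE; apply: eq_bigr => i _; rewrite mulrC. Qed.

(** A named function, rather than a partial application of [dot], so that a
    linear structure can be attached to it; [R^o] is [R] as an [R]-module. *)
Definition dotr f v : R^o := dot v f.

Lemma dotr_is_linear f : linear (dotr f).
Proof.
move=> a u v; rewrite /dotr /dot linearP /= mulmxDl -scalemxAl.
by rewrite mxE [in X in X + _ = _]mxE.
Qed.

HB.instance Definition _ f :=
  GRing.isLinear.Build R 'cV[R]_d R^o _ (dotr f) (dotr_is_linear f).

Lemma dotBl u v f : dot (u - v) f = dot u f - dot v f.
Proof. exact: (linearB (dotr f)). Qed.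

Lemma dotZl a u f : dot (a *: u) f = a * dot u f.
Proof. exact: (linearZ_LR (dotr f)). Qed.

Lemma dot_ge0 v : 0 <= dot v v.
Proof. by rewrite dotE sumr_ge0 // => i _; rewrite -expr2 sqr_ge0. Qed.

Lemma dot_eq0 v : dot v v = 0 -> v = 0.
Proof.
rewrite dotE => /eqP; rewrite psumr_eq0; last first.
  by move=> i _; rewrite -expr2 sqr_ge0.
move=> /allP v0; apply/colP => i; rewrite mxE; apply/eqP.
by have := v0 i (mem_index_enum _); rewrite /= mulf_eq0 orbb.
Qed.

Lemma cauchy_schwarz u v : `|dot u v| <= enorm u * enorm v.
Proof.
rewrite -ler_sqr ?nnegrE ?mulr_ge0 ?sqrtr_ge0//.
rewrite real_normK ?num_real// exprMn !sqr_sqrtr ?dot_ge0//.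
have [/dot_eq0 ->|v0] := eqVneq (dot v v) 0.
  by rewrite (dotC u) /dot trmx0 !mul0mx !mxE expr0n mulr0.
have vv_gt0 : 0 < dot v v by rewrite lt_def v0 dot_ge0.
(* This vector is (v.v) times the component of u orthogonal to v; expanding its
   squared norm gives (v.v) ((u.u) (v.v) - (u.v)^2). *)
have := dot_ge0 (dot v v *: u - dot u v *: v).
rewrite dotBl !dotZl (dotC u) (dotC v (_ - _)) !dotBl !dotZl (dotC v u).
by nra.
Qed.

Lemma enormZ a v : enorm (a *: v) = `|a| * enorm v.
Proof.
by rewrite /enorm dotZl dotC dotZl mulrA sqrtrM -?expr2 ?sqr_ge0// sqrtr_sqr.
Qed.

Lemma dotr_continuous f : continuous (dotr f).
Proof.
have -> : dotr f = fun u => \sum_i u i 0 * f i 0.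
  by apply/funext => u; exact: dotE.
apply: continuous_big; first exact: add_continuous.
move=> i _ u; apply: (@cvgMr_tmp _ _ (nbhs u) _ (fun w => w i 0)).
exact: coord_continuous.
Qed.

Lemma differentiable_dotr f v : differentiable (dotr f) v.
Proof.
exact: (@linear_differentiable _ _ _ (dotr f) v (dotr_continuous f)).
Qed.

Lemma differentiable_ridge (g : R -> R) f v :
  derivable g (dot v f) 1 -> differentiable (fun u => g (dot u f)) v.
Proof.
move=> /derivable1_diffP dg.
exact: (@differentiable_comp _ _ R R (dotr f) g v (differentiable_dotr f v) dg).
Qed.

(** Chain rule: the gradient of a ridge function always points along [f], so
    comparing gradients at two points reduces to comparing two values of the
    scalar derivative. *)
Lemma gradient_ridge (g : R -> R) f v :
  derivable g (dot v f) 1 ->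
  gradient (fun u => g (dot u f)) v = g^`()%classic (dot v f) *: f.
Proof.
move=> dg; have dg' := dg; move/derivable1_diffP : dg' => dg'.
apply/colP => j; rewrite !mxE deriveE; last exact: differentiable_ridge.
rewrite (@diff_comp _ _ R R (dotr f) g v (differentiable_dotr f v) dg') /=.
rewrite (@diff_lin _ _ _ (dotr f) v (dotr_continuous f)) diff1E//.
rewrite /GRing.scale/= mulrC; congr (_ * _).
rewrite /dotr dotE (bigD1 j)//= mxE !eqxx mul1r big1 ?addr0// => i ij.
by rewrite mxE (negPf ij) mul0r.
Qed.

End EuclideanSpace.

(** * Subtracting a quadratic from a scalar loss *)

Section ScalarLoss.
Context {R : realType}.
Implicit Types (f : R -> R) (K L beta r z w : R).

Lemma lipschitzP K (A : set R) f :
  K.-lipschitz_A f <->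
  forall z w, A z -> A w -> `|f z - f w| <= K * `|z - w|.
Proof.
split=> [fK z w Az Aw|fK [z w] [/= Az Aw]]; last exact: fK.
exact: (fK (z, w) (conj Az Aw)).
Qed.

(** The radius is positive, so the interval contains two distinct points. *)
Lemma lipschitz_ge0 K r f : 0 < r -> K.-lipschitz_(abs_le r) f -> 0 <= K.
Proof.
move=> r0 /lipschitzP/(_ r 0); rewrite /abs_le/= normr0 subr0 gtr0_norm//.
move=> /(_ (lexx _) (ltW r0)) fK; have := le_trans (normr_ge0 _) fK.
by rewrite pmulr_lge0.
Qed.

(** On the interval, the subtracted quadratic has slope at most
    [beta * r] in absolute value. *)
Lemma lipschitz_subr_sqr L beta r f : 0 <= beta ->
  L.-lipschitz_(abs_le r) f ->
  (L + beta * r).-lipschitz_(abs_le r) (fun z => f z - beta / 2 * z ^+ 2).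
Proof.
move=> beta0 /lipschitzP fL; apply/lipschitzP => z w Az Aw.
rewrite (_ : _ - _ = f z - f w - beta / 2 * (z + w) * (z - w)); last by field.
rewrite (le_trans (ler_normB _ _))// mulrDl lerD ?fL//.
rewrite normrM ler_wpM2r// normrM ger0_norm ?divr_ge0// -mulrA ler_wpM2l//.
by have := ler_normD z w; move: Az Aw; rewrite /abs_le/=; lra.
Qed.

Lemma is_derive_subr_sqr beta f z : derivable f z 1 ->
  is_derive z 1 (fun t => f t - beta / 2 * t ^+ 2) (f^`()%classic z - beta * z).
Proof.
move=> df; have fz : is_derive z 1 f (f^`()%classic z).
  by rewrite derive1E; exact: derivableP.
have -> : (fun t => f t - beta / 2 * t ^+ 2) = f - (beta / 2) *: (@id R) ^+ 2.
  by apply/funext => t.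
apply: is_derive_eq.
by rewrite /GRing.scale/= expr1; field.
Qed.

(** By the mean value theorem applied to the first derivative: a second
    derivative bounded below by [beta] makes the first derivative increase at
    rate at least [beta]. *)
Lemma derive1_incr_ge beta r f :
  (forall z, abs_le r z -> twice_derivable f z) ->
  (forall z, abs_le r z -> beta <= f^`(2)%classic z) ->
  forall w z, abs_le r w -> abs_le r z -> w <= z ->
  beta * (z - w) <= f^`()%classic z - f^`()%classic w.
Proof.
move=> f2 fb w z Aw Az wz.
have wzA t : t \in `[w, z]%R -> abs_le r t.
  move: Aw Az; rewrite /abs_le/= in_itv/= !ler_norml.
  by move=> /andP[? ?] /andP[? ?] /andP[? ?]; apply/andP; split; lra.
have [||c /wzA Ac ->] := @MVT_segment _ f^`() (f^`(2)%classic) w z wz.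
- move=> t /subset_itv_oo_cc /wzA/f2[_ dt].
  by rewrite /derive1n/= derive1E; exact: derivableP.
- by apply: derivable_within_continuous => t /wzA/f2[].
- by rewrite ler_wpM2r ?subr_ge0// fb.
Qed.

(** The increments of the derivative of [f] lie between [beta] and [L] times the
    increment of the argument. Subtracting the quadratic shifts both bounds down
    by [beta], to [0] and [L - beta]: smoothness improves because the lower
    bound stays nonnegative, whereas the triangle inequality would only give
    [L + beta]. *)
Lemma smooth_on_subr_sqr L beta r f :
  (forall z, abs_le r z -> twice_derivable f z) ->
  (forall z, abs_le r z -> beta <= f^`(2)%classic z) ->
  smooth_on L (abs_le r) f ->
  smooth_on (L - beta) (abs_le r) (fun z => f z - beta / 2 * z ^+ 2).
Proof.
move=> f2 fb [df /lipschitzP fL].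
have dg z Az := is_derive_subr_sqr beta f z (df z Az).
split=> [z /dg//|].
apply/lipschitzP.
have key z w : abs_le r z -> abs_le r w -> w <= z ->
  `|(fun z => f z - beta / 2 * z ^+ 2)^`()%classic z -
    (fun z => f z - beta / 2 * z ^+ 2)^`()%classic w| <= (L - beta) * `|z - w|.
  move=> Az Aw wz; rewrite !derive1E.
  rewrite (@derive_val _ _ _ _ _ _ _ (dg _ Az)).
  rewrite (@derive_val _ _ _ _ _ _ _ (dg _ Aw)).
  have := derive1_incr_ge beta r f f2 fb w z Aw Az wz.
  have := fL z w Az Aw; rewrite (ger0_norm (x := z - w)) ?subr_ge0//.
  by rewrite !ler_norml => /andP[_ ?] ?; apply/andP; split; lra.
move=> z w Az Aw; have [wz|/ltW zw] := leP w z; first exact: key.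
by rewrite distrC (distrC z); exact: key.
Qed.

End ScalarLoss.

(** * Condition numbers from feature norms *)

Section ConditionNumberBounds.
Context {R : realType} {n d : nat}.
Variables (r : R) (P : rlm_problem R n d) (K M : R) (i0 : 'I_n).
Hypotheses (r_gt0 : 0 < r) (reg_ge0 : 0 <= reg P).
Hypothesis feature_le : forall i, dot (feature P i) (feature P i) <= M.

Let M_ge0 : 0 <= M := le_trans (dot_ge0 _) (feature_le i0).

Let enorm_feature i : enorm (feature P i) <= Num.sqrt M.
Proof. by rewrite ler_wsqrtr. Qed.

(** By Cauchy-Schwarz, composing with the linear form of a feature multiplies
    the Lipschitz constant by at most the norm of the feature, itself at most
    the square root of [M]. *)
Lemma cond_lipschitz_le :
  (forall i, K.-lipschitz_(abs_le r) (loss P i)) ->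
  (cond_lipschitz r P <= (K ^+ 2 * M / reg P)%:E)%E.
Proof.
move=> lossK; have K_ge0 : 0 <= K := lipschitz_ge0 _ _ _ r_gt0 (lossK i0).
have KP : common_lipschitz r P (K * Num.sqrt M).
  split=> [|i v w vr wr]; first by rewrite mulr_ge0 ?sqrtr_ge0.
  move/lipschitzP: (lossK i) => lossKi.
  rewrite (le_trans (lossKi _ _ vr wr))// -mulrA ler_wpM2l// -dotBl.
  rewrite (le_trans (cauchy_schwarz _ _))// mulrC ler_wpM2r ?sqrtr_ge0//.
have lip_le : (lipschitz_const r P <= (K * Num.sqrt M)%:E)%E.
  by apply: ereal_inf_lbound; exists (K * Num.sqrt M).
have lip_ge0 : (0 <= lipschitz_const r P)%E.
  by apply: le_ereal_inf_tmp => _ [k [k0 _] <-]; rewrite lee_fin.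
rewrite /cond_lipschitz EFinM lee_wpmul2r ?lee_fin ?invr_ge0//.
rewrite expe2 -(sqr_sqrtr M_ge0) -exprMn expr2 EFinM.
exact: lee_pmul.
Qed.

(** The norm of the feature enters twice, once through Cauchy-Schwarz in the
    argument of the derivative and once as the length of the gradient direction;
    hence [M] and not its square root. *)
Lemma cond_smooth_le :
  (forall i, smooth_on K (abs_le r) (loss P i)) ->
  (cond_smooth r P <= (K * M / reg P)%:E)%E.
Proof.
move=> lossK; have K_ge0 : 0 <= K := lipschitz_ge0 _ _ _ r_gt0 (lossK i0).2.
rewrite /cond_smooth EFinM lee_wpmul2r ?lee_fin ?invr_ge0//.
apply: ereal_inf_lbound; exists (K * M) => //; split; first exact: mulr_ge0.
move=> i; have [dloss /lipschitzP lossKi] := lossK i.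
split=> [v /dloss|v w vr wr]; first exact: differentiable_ridge.
rewrite !gradient_ridge; [|exact: dloss..].
rewrite -scalerBl enormZ.
rewrite (le_trans (ler_wpM2r (sqrtr_ge0 _) (lossKi _ _ vr wr)))// -!mulrA.
rewrite ler_wpM2l// -dotBl.
rewrite (le_trans (ler_wpM2r (sqrtr_ge0 _) (cauchy_schwarz _ _)))//.
rewrite -mulrA mulrC ler_wpM2r ?sqrtr_ge0//.
by rewrite -expr2 sqr_sqrtr ?dot_ge0.
Qed.

End ConditionNumberBounds.

(** * Square roots of matrices diagonal in an orthonormal basis *)

Section DiagonalInBasis.
Context {R : realType} {d : nat}.
Variables (U : 'M[R]_d).
Hypothesis UTU : U^T *m U = 1%:M.
Implicit Types (a b : 'rV[R]_d).

(** The symmetric operator with eigenvectors the columns of [U] and eigenvalues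
    the entries of [a]. *)
Definition diag_in a : 'M[R]_d := U *m diag_mx a *m U^T.

Lemma diag_inM a b : diag_in a *m diag_in b = diag_in (\row_j (a 0 j * b 0 j)).
Proof.
rewrite /diag_in -!mulmxA (mulmxA U^T) UTU mul1mx (mulmxA (diag_mx a)).
by rewrite mulmx_diag.
Qed.

Lemma diag_in_const c : diag_in (const_mx c) = c%:M.
Proof.
rewrite /diag_in diag_const_mx mul_mx_scalar -scalemxAl (mulmx1C UTU).
by rewrite scale_scalar_mx mulr1.
Qed.

Lemma diag_inD a b : diag_in a + diag_in b = diag_in (a + b).
Proof. by rewrite /diag_in linearD/= mulmxDr mulmxDl. Qed.

Lemma dot_diag_in a (v : 'cV[R]_d) :
  dot v (diag_in a *m v) = \sum_j a 0 j * (U^T *m v) j 0 ^+ 2.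
Proof.
rewrite /dot /diag_in -!mulmxA mulmxA -[v^T *m U]trmxK trmx_mul trmxK.
rewrite mxE; apply: eq_bigr => j _.
by rewrite mxE mul_diag_mx mxE expr2 mulrCA.
Qed.

(** The choice operator returns a genuine root as soon as one exists; taking
    square roots of the eigenvalues exhibits one. *)
Lemma sqrtmx_diag_in a : (forall j, 0 <= a 0 j) ->
  psdmx (sqrtmx (diag_in a)) /\
  sqrtmx (diag_in a) *m sqrtmx (diag_in a) = diag_in a.
Proof.
move=> a0; apply: (@xgetPex _ 0 [set S | psdmx S /\ S *m S = diag_in a]).
exists (diag_in (\row_j Num.sqrt (a 0 j))); split; last first.
  rewrite diag_inM; congr diag_in; apply/rowP => j.
  by rewrite !mxE -expr2 sqr_sqrtr.
split=> [|u]; first by rewrite /diag_in !trmx_mul trmxK tr_diag_mx mulmxA.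
rewrite dot_diag_in sumr_ge0// => j _.
by rewrite mulr_ge0 ?sqr_ge0// mxE sqrtr_ge0.
Qed.

(** The root [S] is symmetric, so the squared norm of [S^-1 v] is [v^T S^-2 v],
    where [S^-2] is the inverse of [diag_in a], itself diagonal in the basis
    [U]. *)
Lemma dot_invmx_sqrtmx a (v : 'cV[R]_d) : (forall j, 0 < a 0 j) ->
  let w := invmx (sqrtmx (diag_in a)) *m v in
  dot w w = \sum_j (U^T *m v) j 0 ^+ 2 / a 0 j.
Proof.
move=> a0 w; have [[ST _] SS] := sqrtmx_diag_in a (fun j => ltW (a0 j)).
have aV : diag_in a *m diag_in (\row_j (a 0 j)^-1) = 1%:M.
  rewrite diag_inM -diag_in_const; congr diag_in; apply/rowP => j.
  by rewrite !mxE mulfV ?gt_eqF.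
have Sunit : sqrtmx (diag_in a) \in unitmx.
  by move: aV; rewrite -[in X in X *m _]SS -mulmxA => /mulmx1_unit[].
rewrite (eq_bigr (fun j => (\row_j (a 0 j)^-1) 0 j * (U^T *m v) j 0 ^+ 2)).
  rewrite -dot_diag_in /dot /w trmx_mul trmx_inv ST -!mulmxA.
  congr ((_ *m _) 0 0).
  (* insert diag_in a times its inverse in front of v, then cancel *)
  rewrite -[v in LHS]mul1mx -aV.
  by rewrite -[X in invmx _ *m (_ *m (X *m _ *m _))]SS -!mulmxA !mulKmx.
by move=> j _; rewrite mxE mulrC.
Qed.

End DiagonalInBasis.

(** * Norms of the preconditioned features *)

Section Data.
Context {R : realType} {n d : nat}.
Variables (x : 'I_n -> 'cV[R]_d) (U : 'M[R]_d) (sigma : 'rV[R]_d).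
Variables (V : 'M[R]_(n, d)) (rho : R).
Hypotheses (svdX : is_svd x U sigma V) (rho_gt0 : 0 < rho).

Let UTU : U^T *m U = 1%:M := svd_left svdX.

Lemma second_moment_data_mx :
  second_moment x = n%:R^-1 *: (data_mx x *m (data_mx x)^T).
Proof.
congr (_ *: _); apply/matrixP => j k; rewrite summxE mxE.
by apply: eq_bigr => i _; rewrite !mxE big_ord1 !mxE.
Qed.

Lemma second_moment_svd :
  second_moment x = diag_in U (\row_j (sigma 0 j ^+ 2)).
Proof.
rewrite second_moment_data_mx.
have -> : n%:R^-1 *: (data_mx x *m (data_mx x)^T) =
    ((Num.sqrt n%:R)^-1 *: data_mx x) *m ((Num.sqrt n%:R)^-1 *: data_mx x)^T.
  rewrite linearZ/= -scalemxAl -scalemxAr scalerA -invfM -expr2 sqr_sqrtr//.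
rewrite (svd_eq svdX) !trmx_mul trmxK tr_diag_mx -!mulmxA (mulmxA V^T).
rewrite (svd_right svdX) mul1mx (mulmxA (diag_mx _)) mulmx_diag mulmxA.
by congr (_ *m diag_mx _ *m _); apply/rowP => j; rewrite !mxE expr2.
Qed.

Lemma reg_second_moment_svd :
  reg_second_moment x rho = diag_in U (\row_j (sigma 0 j ^+ 2 + rho)).
Proof.
rewrite /reg_second_moment second_moment_svd -(diag_in_const _ UTU) diag_inD.
by congr diag_in; apply/rowP => j; rewrite !mxE addrC.
Qed.

(** The left singular basis diagonalizes everything: in it, the data points are
    the rows of [V], scaled by the singular values and by [sqrt n]. *)
Lemma coord_data_svd i j :
  (U^T *m x i) j 0 = Num.sqrt n%:R * sigma 0 j * V i j.
Proof.
have n_gt0 : 0 < n%:R :> R by rewrite ltr0n (leq_ltn_trans _ (ltn_ord i)).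
have UX : U^T *m data_mx x = Num.sqrt n%:R *: (diag_mx sigma *m V^T).
  rewrite -[diag_mx _ *m _]mul1mx -UTU -mulmxA (mulmxA U) -(svd_eq svdX).
  by rewrite -scalemxAr scalerA divff ?scale1r// gt_eqF// sqrtr_gt0.
have -> : x i = col i (data_mx x) by apply/colP => k; rewrite !mxE.
by rewrite colE mulmxA UX -colE 2!mxE mul_diag_mx !mxE mulrA.
Qed.

(** This ridge leverage score of the [i]-th point is the quantity whose maximum
    over [i] is the incoherence, up to the normalization by the numerical
    rank. *)
Lemma precond_feature_sqr i :
  let xhat := invmx (sqrtmx (reg_second_moment x rho)) *m x i in
  dot xhat xhat =
  n%:R * \sum_j sigma 0 j ^+ 2 / (sigma 0 j ^+ 2 + rho) * V i j ^+ 2.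
Proof.
rewrite /= reg_second_moment_svd dot_invmx_sqrtmx//; last first.
  by move=> j; rewrite mxE ltr_wpDl ?sqr_ge0.
rewrite mulr_sumr; apply: eq_bigr => j _.
rewrite coord_data_svd mxE !exprMn sqr_sqrtr//; ring.
Qed.

(** The rank cancels the normalization of the incoherence only when it is
    nonzero: if it vanished, so would all singular values, hence the data. *)
Lemma numerical_rank_gt0 : (exists i, x i != 0) -> 0 < numerical_rank sigma rho.
Proof.
move=> [i xi0].
have term_ge0 j : 0 <= sigma 0 j ^+ 2 / (sigma 0 j ^+ 2 + rho).
  by rewrite divr_ge0 ?addr_ge0 ?sqr_ge0// ltW.
rewrite lt_def sumr_ge0// andbT; apply: contraNneq xi0.
move=> /eqP; rewrite psumr_eq0// => /allP rank0.
have sigma0 j : sigma 0 j = 0.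
  have := rank0 j (mem_index_enum _).
  rewrite /= mulf_eq0 invr_eq0 [X in _ || X]gt_eqF ?ltr_wpDl ?sqr_ge0// orbF.
  by rewrite expf_eq0/= => /eqP.
rewrite -[x i]mul1mx -(mulmx1C UTU) -mulmxA.
suff -> : U^T *m x i = 0 by rewrite mulmx0.
by apply/colP => j; rewrite coord_data_svd sigma0 mulr0 mul0r mxE.
Qed.

Lemma precond_feature_le i : (exists i, x i != 0) ->
  let xhat := invmx (sqrtmx (reg_second_moment x rho)) *m x i in
  dot xhat xhat <= incoherence sigma V rho * numerical_rank sigma rho.
Proof.
move=> /numerical_rank_gt0 rank_gt0.
rewrite /= precond_feature_sqr -ler_pdivrMr// mulrAC.
exact: (@le_bigmax _ _ _ 0 _ i).
Qed.

End Data.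

(** * Condition number of the preconditioned problem *)

Theorem theorem5 (R : realType) (n d : nat) (Y : Type)
    (x : 'I_n -> 'cV[R]_d) (y : 'I_n -> Y) (ell : R -> Y -> R)
    (r lambda beta rho : R)
    (U : 'M[R]_d) (sigma : 'rV[R]_d) (V : 'M[R]_(n, d))
    (le_dn : (d <= n)%N)
    (x_neq0 : exists i, x i != 0)
    (svdX : is_svd x U sigma V)
    (r_gt0 : 0 < r) (lambda_gt0 : 0 < lambda) (beta_gt0 : 0 < beta)
    (rhoE : rho = lambda / beta)
    (ell_convex : forall b : Y, convex_function (abs_le r) (ell ^~ b))
    (ell_twice : forall i z, abs_le r z -> twice_derivable (ell ^~ (y i)) z)
    (ell_strong : forall i z, abs_le r z -> beta <= (ell ^~ (y i))^`(2) z) :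
  (forall L : R,
     (forall i, L.-lipschitz_(abs_le r) (ell ^~ (y i))) ->
     (cond_lipschitz r (precond_problem ell y x beta rho) <=
      ((L + beta * r) ^+ 2 * incoherence sigma V rho *
         numerical_rank sigma rho / beta)%:E)%E) /\
  (forall L : R,
     (forall i, smooth_on L (abs_le r) (ell ^~ (y i))) ->
     (cond_smooth r (precond_problem ell y x beta rho) <=
      ((L - beta) * incoherence sigma V rho *
         numerical_rank sigma rho / beta)%:E)%E).
Proof.
have rho_gt0 : 0 < rho by rewrite rhoE divr_gt0.
have feature_le i := precond_feature_le _ _ _ _ _ svdX rho_gt0 i x_neq0.
have [i0 _] := x_neq0.
split=> L ellL.
- rewrite -(mulrA (_ ^+ 2)).
  apply: cond_lipschitz_le => //= [|i]; first exact: ltW.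
  exact/lipschitz_subr_sqr/ellL/ltW.
- rewrite -(mulrA (L - beta)).
  apply: cond_smooth_le => //= [|i]; first exact: ltW.
  exact: smooth_on_subr_sqr (ell_twice i) (ell_strong i) (ellL i).
Qed.
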